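(* Let $G$ be a graph of order $n$. For every vertex set $M\subseteq V(G)$ and every edge $e$ of $G$, we have $$0 \leq |P(M, e)| \leq n(n-1).$$ Moreover, the bounds are sharp (each of the two bounds is attained for some $G$, $M$, $e$).
   Context: Graphs are finite, undirected and simple; the order of a graph is its number of vertices. $d_G(x,y)$ is the distance between $x$ and $y$ in $G$ ($\infty$ if there is no path), and $G-e$ is the graph obtained from $G$ by deleting the edge $e$. For $M\subseteq V(G)$ and an edge $e$ of $G$, $P(M,e)$ is the set of ordered pairs $(x,y)$ with $x\in M$, $y\in V(G)$ and $d_G(x,y)\neq d_{G-e}(x,y)$. *)

(* Defs.v *)
From mathcomp Require Import all_boot.

Set Implicit Arguments.
Unset Strict Implicit.
Unset Printing Implicit Defensive.

Record sgraph := SGraph {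
  vertex :> finType;
  adj : rel vertex;
  adj_sym : symmetric adj;
  adj_irrefl : irreflexive adj
}.

Definition edges (G : sgraph) : {set {set G}} :=
  [set [set p.1; p.2] | p : G * G & adj p.1 p.2].

Section DeleteEdge.

Variables (G : sgraph) (e : {set G}).

Definition del_edge_rel : rel G := [rel x y | adj x y && ([set x; y] != e)].

Lemma del_edge_sym : symmetric del_edge_rel.
Proof. by move=> x y; rewrite /del_edge_rel /= adj_sym setUC. Qed.

Lemma del_edge_irrefl : irreflexive del_edge_rel.
Proof. by move=> x; rewrite /del_edge_rel /= adj_irrefl. Qed.

Definition del_edge : sgraph := SGraph del_edge_sym del_edge_irrefl.

End DeleteEdge.

Section Distance.

Variable G : sgraph.

(* The vertices of the path are x, followed by the k items of p, so that its
   number of edges is k. *)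
Definition has_path (x y : G) (k : nat) : bool :=
  [exists p : k.-tuple G,
    [&& path (@adj G) x p, uniq (x :: p) & last x p == y]].

Lemma connect_has_path (x y : G) :
  connect (@adj G) x y -> exists k, has_path x y k.
Proof.
case/connectP=> p0 /shortenP[p xp Up _] ->.
by exists (size p); apply/existsP; exists (in_tuple p); rewrite xp Up eqxx.
Qed.

(* None stands for an infinite distance. *)
Definition dist (x y : G) : option nat :=
  match decP (@idP (connect (@adj G) x y)) with
  | left xy => Some (ex_minn (connect_has_path xy))
  | right _ => None
  end.

End Distance.

Definition monitored_pairs (G : sgraph) (M : {set G}) (e : {set G}) :
    {set G * G} :=
  [set p : G * G |
    (p.1 \in M) && (@dist G p.1 p.2 != @dist (del_edge e) p.1 p.2)].

(* Main.v *)
Require Import Defs.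
From mathcomp Require Import all_boot.

(** The distance from a vertex to itself is 0 in both graphs, so a monitored
    pair lies off the diagonal, which gives the upper bound.  The lower bound
    is attained by M empty, and the upper one by the single edge of K_2 with M
    the whole vertex set. *)

Lemma dist_diag (G : sgraph) (x : G) : dist x x = Some 0.
Proof.
rewrite /dist; case: decP => [xx|]; last by rewrite connect0.
case: ex_minnP => m _ /(_ 0) m_min; congr Some; apply/eqP; rewrite -leqn0.
by apply: m_min; apply/existsP; exists [tuple]; rewrite /= eqxx.
Qed.

(** Lets a change from finite to infinite distance be detected by connectivity alone, with no
    shortest length to compute. *)
Lemma isSome_dist (G : sgraph) (x y : G) :
  isSome (dist x y) = connect (@adj G) x y.
Proof. by rewrite /dist; case: decP => /= [->|/negP/negbTE->]. Qed.

(** The complement is the diagonal, the image of [T] under an injective map. *)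
Lemma card_offdiag (T : finType) :
  #|[set p : T * T | p.1 != p.2]| = #|T| * (#|T| - 1).
Proof.
have -> : [set p : T * T | p.1 != p.2] = ~: [set (x, x) | x : T].
  apply/setP=> -[x y]; rewrite !inE /=; congr (~~ _).
  by apply/eqP/imsetP => [->|[z _ [-> ->]]] //; exists y.
rewrite cardsCs setCK card_imset; last by move=> x y [].
by rewrite card_prod mulnBr muln1.
Qed.

Lemma monitored_pairs_sub_offdiag (G : sgraph) (M e : {set G}) :
  monitored_pairs M e \subset [set p : G * G | p.1 != p.2].
Proof.
apply/subsetP=> -[x y]; rewrite !inE /= => /andP[_]; apply: contraNneq => ->.
by rewrite dist_diag (@dist_diag (del_edge e)).
Qed.

Definition K2_adj : rel bool := [rel x y | x != y].

Lemma K2_adj_sym : symmetric K2_adj.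
Proof. by case=> -[]. Qed.

Lemma K2_adj_irrefl : irreflexive K2_adj.
Proof. by case. Qed.

Definition K2 : sgraph := SGraph K2_adj_sym K2_adj_irrefl.

(** An edge is encoded as the set of its ends, here both vertices. *)
Lemma setT_edge_K2 : [set: K2] \in edges K2.
Proof.
apply/imsetP; exists (true, false); first by rewrite inE.
by apply/setP=> -[]; rewrite !inE.
Qed.

(** Deleting the only edge disconnects the two vertices, so their distance goes from 1 to
    infinity. *)
Lemma monitored_pairs_K2 :
  monitored_pairs [set: K2] [set: K2] = [set p : K2 * K2 | p.1 != p.2].
Proof.
apply/eqP; rewrite eqEsubset monitored_pairs_sub_offdiag /=.
apply/subsetP=> -[x y]; rewrite !inE /= => neq_xy.
apply/eqP=> /(congr1 isSome); rewrite !isSome_dist connect1 //.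
(* A path after the deletion is either empty, forcing [x = y], or starts with a surviving edge from
   [x] to some [z]. *)
case/esym/connectP=> -[_ /= eq_yx|z p /= /andP[/andP[neq_xz /eqP xz_kept] _] _].
  by rewrite eq_yx eqxx in neq_xy.
(* Being distinct, [x] and [z] are all the vertices, so this edge is the deleted one. *)
apply: xz_kept; apply/setP=> t; rewrite !inE.
by case: x z t neq_xz {neq_xy} => [] [] [].
Qed.

Theorem proposition3p3 :
  (forall (G : sgraph) (n : nat), #|G| = n ->
     forall (M : {set G}) (e : {set G}), e \in edges G ->
       0 <= #|monitored_pairs M e| <= n * (n - 1)) /\
  (exists (G : sgraph) (M : {set G}) (e : {set G}),
     e \in edges G /\ #|monitored_pairs M e| = 0) /\
  (exists (G : sgraph) (M : {set G}) (e : {set G}),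
     e \in edges G /\ #|monitored_pairs M e| = #|G| * (#|G| - 1)).
Proof.
split=> [G n <- M e _|].
  by rewrite /= -card_offdiag subset_leq_card ?monitored_pairs_sub_offdiag.
split; exists K2.
  exists set0, setT; split; first exact: setT_edge_K2.
  by apply: eq_card0 => p; rewrite !inE.
exists setT, setT; split; first exact: setT_edge_K2.
by rewrite monitored_pairs_K2 card_offdiag.
Qed.
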